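(* For each $n\geq 3$ there exist distinct points $\zeta_1,\zeta_2\in\mathbb{D}$ and matrices $W_1,W_2\in\Omega_n$ such that: (i) the inequality $$\max\left\{\max_{\mu\in\sigma(W_2)}\ \prod_{\lambda\in\sigma(W_1)}\mathcal{M}_{\mathbb{D}}(\mu,\lambda)^{m_1(\lambda)},\ \ \max_{\lambda\in\sigma(W_1)}\ \prod_{\mu\in\sigma(W_2)}\mathcal{M}_{\mathbb{D}}(\lambda,\mu)^{m_2(\mu)}\right\}\ \leq\ \left|\frac{\zeta_1-\zeta_2}{1-\overline{\zeta_2}\,\zeta_1}\right|,$$ which is necessary for the existence of a holomorphic map $F:\mathbb{D}\longrightarrow\Omega_n$ with $F(\zeta_1)=W_1$ and $F(\zeta_2)=W_2$, is violated (so that no such $F$ exists); whereas (ii) the condition $$\left[\frac{1-\overline{f(z;W_j)}\,f(z;W_k)}{1-\overline{\zeta_j}\,\zeta_k}\right]_{j,k=1}^2\ \geq\ 0\quad\text{for each } z\in\overline{\mathbb{D}}$$ is satisfied.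
   Context: $\mathbb{D}$ is the open unit disc in $\mathbb{C}$ centered at $0$. $M_n(\mathbb{C})$ is the space of $n\times n$ complex matrices, $r(W)$ is the spectral radius of $W$, and $\Omega_n:=\{W\in M_n(\mathbb{C}): r(W)<1\}$ is the spectral unit ball, viewed as an open subset of $\mathbb{C}^{n^2}$. The pseudohyperbolic distance on $\mathbb{D}$ is $\mathcal{M}_{\mathbb{D}}(z_1,z_2):=\left|\frac{z_1-z_2}{1-\overline{z_2}z_1}\right|$. For $j=1,2$, $\sigma(W_j)$ is the set of eigenvalues of $W_j$ (not repeated according to multiplicity), and for $\lambda\in\sigma(W_j)$, $m_j(\lambda)$ is the multiplicity of $\lambda$ as a zero of the minimal polynomial of $W_j$. For $W\in M_n(\mathbb{C})$ write its characteristic polynomial as $\chi^W(z)=z^n+\sum_{j=1}^n(-1)^js_j(W)z^{n-j}$, put $s_0(W):=1$, and define the rational function $$f(z;W):=\frac{\sum_{j=1}^n j\,s_j(W)(-1)^jz^{j-1}}{\sum_{j=0}^{n-1}(n-j)\,s_j(W)(-1)^jz^{j}}.$$ For $W\in\Omega_n$ this function has no poles in $\overline{\mathbb{D}}$. For a Hermitian matrix, ''$\geq 0$'' means positive semi-definite. *)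

(* Defs.v *)
From HB Require Import structures.
From mathcomp Require Import all_boot all_order all_algebra.
From mathcomp Require Import complex finmap.
From mathcomp Require Import all_classical all_reals all_analysis.

Set Implicit Arguments.
Unset Strict Implicit.
Unset Printing Implicit Defensive.

Import Order.TTheory GRing.Theory Num.Theory.
Import ComplexField.
Import numFieldNormedType.Exports.

Local Open Scope classical_set_scope.
Local Open Scope ring_scope.

Definition unit_disc (R : realType) (z : R[i]) : Prop := `|z| < 1.

Definition closed_unit_disc (R : realType) (z : R[i]) : Prop := `|z| <= 1.

(* [Normc.normc] is the modulus with values in [R]; the norm [`|_|] of [R[i]]
   takes values in [R[i]] itself. *)
Definition pseudohyp (R : realType) (z1 z2 : R[i]) : R :=
  Normc.normc ((z1 - z2) / (1 - z2^* * z1)).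

(* Set of eigenvalues, as a duplicate-free finite set; [in_spectrum] shows that
   the default value of [fset_set] on infinite sets plays no role. *)
Definition spectrum (R : realType) (n : nat) (W : 'M[R[i]]_n) : {fset R[i]} :=
  fset_set [set a | eigenvalue W a].

Lemma in_spectrum (R : realType) (n : nat) (W : 'M[R[i]]_n) (a : R[i]) :
  (a \in spectrum W) = eigenvalue W a.
Proof.
rewrite in_fset_set; last first.
  have p0 : char_poly W != 0 by apply/monic_neq0/char_poly_monic.
  have [r Dr] := closed_field_poly_normal (char_poly W).
  apply: (@sub_finite_set _ _ [set` r]); last exact: finite_seq.
  move=> x /=; rewrite eigenvalue_root_char Dr rootZ ?lead_coef_eq0//.
  by rewrite root_prod_XsubC.
by apply/idP/idP; rewrite inE.
Qed.

(* The default [0] of the maximum is harmless: moduli are nonnegative. *)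
Definition spectral_radius (R : realType) (n : nat) (W : 'M[R[i]]_n) : R :=
  \big[Num.max/0]_(a <- spectrum W) Normc.normc a.

Definition spectral_ball (R : realType) (n : nat) (W : 'M[R[i]]_n) : Prop :=
  spectral_radius W < 1.

(* [mxminpoly] is only available for sizes of the form [n.+1]. *)
Definition min_mult (R : realType) (n : nat) (W : 'M[R[i]]_n.+1) (a : R[i]) :
  nat := mup a (mxminpoly W).

(* Maximum over the spectrum of [V] of the modulus of the finite Blaschke product
   whose zeros are those of the minimal polynomial of [W]. *)
Definition max_blaschke (R : realType) (n : nat) (W V : 'M[R[i]]_n.+1) : R :=
  \big[Num.max/0]_(b <- spectrum V)
    \prod_(a <- spectrum W) pseudohyp b a ^+ min_mult W a.

(* [char_poly W = 'X^n + \sum_(1 <= j < n.+1) (-1)^j s_j 'X^(n-j)]. *)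
Definition char_s (R : realType) (n : nat) (W : 'M[R[i]]_n) (j : nat) : R[i] :=
  (-1) ^+ j * (char_poly W)`_(n - j).

(* For [W] in the spectral unit ball, the denominator does not vanish on the
   closed unit disc, so the pointwise quotient is the value of the rational
   function there. *)
Definition char_frac (R : realType) (n : nat) (z : R[i]) (W : 'M[R[i]]_n) :
  R[i] :=
  (\sum_(1 <= j < n.+1) j%:R * char_s W j * (-1) ^+ j * z ^+ j.-1) /
  (\sum_(0 <= j < n) (n - j)%:R * char_s W j * (-1) ^+ j * z ^+ j).

Definition psd (R : realType) (n : nat) (A : 'M[R[i]]_n) : Prop :=
  A \is hermsymmx /\
  forall v : 'cV[R[i]]_n, 0 <= ((map_mx Num.conj v)^T *m A *m v) 0 0.

Definition pick_matrix (R : realType) (zeta1 zeta2 w1 w2 : R[i]) :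
  'M[R[i]]_2 :=
  let zeta (j : 'I_2) := tnth [tuple zeta1; zeta2] j in
  let w (j : 'I_2) := tnth [tuple w1; w2] j in
  \matrix_(j, k) ((1 - (w j)^* * w k) / (1 - (zeta j)^* * zeta k)).

(* Complex differentiability of every entry at every point of the disc: the
   scalar field of [derivable] is [R[i]] ([R[i]^o] is [R[i]] as a normed space
   over itself), so the increment tends to [0] through complex numbers.  The
   values of [F] outside of the disc are irrelevant. *)
Definition holomorphic_disc (R : realType) (n : nat) (F : R[i] -> 'M[R[i]]_n) :
    Prop :=
  forall (i j : 'I_n) (z : R[i]), unit_disc z ->
    derivable (fun x : R[i]^o => F x i j : R[i]^o) z 1.

Definition interpolable (R : realType) (n : nat) (zeta1 zeta2 : R[i])
    (W1 W2 : 'M[R[i]]_n) : Prop :=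
  exists F : R[i] -> 'M[R[i]]_n,
    [/\ holomorphic_disc F,
        forall z, unit_disc z -> spectral_ball (F z),
        F zeta1 = W1 & F zeta2 = W2].

(* Main.v *)
Require Import Defs.
From mathcomp Require Import all_boot all_order all_algebra.
From mathcomp Require Import complex finmap.
From mathcomp Require Import all_classical all_reals all_analysis.
From mathcomp Require Import ring lra.

Set Implicit Arguments.
Unset Strict Implicit.
Unset Printing Implicit Defensive.

Import Order.TTheory GRing.Theory Num.Theory.
Import numFieldNormedType.Exports.

Local Open Scope classical_set_scope.
Local Open Scope ring_scope.

(** Write N for the size of the matrices.  Take zeta1 = 0, zeta2 = 1 / (N + 1),
W1 = 0 and W2 = E_00 / 2, where E_00 is the matrix unit at the top left corner.
The characteristic polynomial of a E_00 is X^(N-1) (X - a), so that f(z; W1) = 0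
and f(z; W2) = - a / (N - (N - 1) a z) with a = 1/2, whose modulus is at most
1 / (N + 1) = |zeta2| for |z| <= 1.  As zeta1 and f(z; W1) vanish, this bound is
exactly what makes the Pick matrix positive semidefinite
([psd_pick_matrix0]).  On the other hand the minimal polynomial of W1 is X, so
the first maximum in the spectral inequality is at least 1/2, which exceeds
|zeta2| ([max_blaschke_delta]).

An interpolating F would satisfy F(0) = 0.  Hence tr (F(z)^k) / z^k =
tr ((F(z) / z)^k) extends continuously to 0, and on the circle of radius r < 1
it is bounded by N / r^k, because the trace of the k-th power of a matrix of
the spectral ball is a sum of N numbers of modulus at most 1
([mxtrace_exp_le]).  The maximum modulus principle carries this bound to zeta2
([trace_exp_schwarz]): (1/2)^k <= N (|zeta2| / r)^k.  As |zeta2| <= 1/4, this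
fails for r = 3/4 and k = 2 N ([not_interpolable_delta]).

The maximum modulus principle ([max_modulus]) is needed for a function that is
only known to be complex differentiable outside of a point and continuous there.
It is derived from Goursat's theorem ([rect_circ_eq0]), in real form: if P dx +
Q dy is totally differentiable at each point of a rectangle, with P_y = Q_x
there, its integral along the boundary vanishes.  Only antiderivatives of P and
Q along horizontal and vertical lines are needed to express that integral.
Applied to Im g dx + Re g dy after the change of variable z = a + exp(x + i y),
whose periodicity in y makes the horizontal sides cancel, it shows that the mean
of Re g over a circle centred at a does not depend on the radius, so that Re g
has no strict quadratic local maximum at a ([no_strict_peak]).  If
|q| exceeded inside a disc its bound on the boundary circle, the maximum of
|q(z)| + e |z|^2 would be attained inside for a small e, and a suitable
multiple of q plus an affine function would have such a peak there. *)

(** * Goursat's theorem on rectangles *)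

Lemma nested_point (R : realType) (u v : nat -> R) :
  (forall n, u n <= u n.+1) -> (forall n, v n.+1 <= v n) ->
  (forall n, u n <= v n) -> exists p, forall n, u n <= p <= v n.
Proof.
move=> ui vd uv.
have uV m n : u m <= v n.
  have um : u m <= u (maxn m n).
    rewrite -(subnKC (leq_maxl m n)); elim: (_ - _)%N => [|k]; first by rewrite addn0.
    by move=> /le_trans; apply; rewrite addnS.
  have vn : v (maxn m n) <= v n.
    rewrite -(subnKC (leq_maxr m n)); elim: (_ - _)%N => [|k]; first by rewrite addn0.
    by apply: le_trans; rewrite addnS.
  exact: le_trans um (le_trans (uv _) vn).
have su n : ubound (range u) (v n) by move=> _ [m _ <-].
exists (sup (range u)) => n; apply/andP; split.
  apply: ub_le_sup; last by exists n.
  by exists (v 0%N); exact: su.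
by apply: ge_sup => //; exists (u 0%N); exists 0%N.
Qed.

(** Repeated halving of the rectangle with corner (x0, y0) and sides w and h: if
[bad x y n], read as a property of the rectangle with corner (x, y) and sides
w / 2^n and h / 2^n, always passes to some subrectangle with sides half as long,
then there are bad rectangles of each level n around a common point. *)
Lemma bisection_point (R : realType) (bad : R -> R -> nat -> Prop) (x0 y0 w h : R) :
  0 <= w -> 0 <= h -> bad x0 y0 0%N ->
  (forall x y n, bad x y n -> exists x' y',
     [/\ bad x' y' n.+1, x <= x' <= x + w / 2 ^+ n.+1 &
         y <= y' <= y + h / 2 ^+ n.+1]) ->
  exists px py, forall n, exists x y,
    [/\ bad x y n, x <= px <= x + w / 2 ^+ n, y <= py <= y + h / 2 ^+ n,
        x0 <= x /\ x + w / 2 ^+ n <= x0 + w &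
        y0 <= y /\ y + h / 2 ^+ n <= y0 + h].
Proof.
move=> w0 h0 bad0 next.
pose good (s : (R * R) * nat) (t : R * R) := bad s.1.1 s.1.2 s.2 ->
    [/\ bad t.1 t.2 s.2.+1, s.1.1 <= t.1 <= s.1.1 + w / 2 ^+ s.2.+1 &
         s.1.2 <= t.2 <= s.1.2 + h / 2 ^+ s.2.+1].
have /choice[f Hf] : forall s, exists t, good s t.
  move=> [[x y] n]; rewrite /good /=.
  have [b|nb] := pselect (bad x y n); last by exists (x, y).
  by have [x' [y' ?]] := next _ _ _ b; exists (x', y').
pose s := fix s n := if n is m.+1 then f (s m, m) else (x0, y0).
have sbad n : bad (s n).1 (s n).2 n.
  by elim: n => [//|n IH] /=; have [] := Hf (s n, n) IH.
have half (t : R) n : t / 2 ^+ n = t / 2 ^+ n.+1 + t / 2 ^+ n.+1.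
  by rewrite exprS invfM; field; rewrite expf_neq0.
have pw (t : R) n : 0 <= t -> 0 <= t / 2 ^+ n by move=> ?; rewrite divr_ge0 ?exprn_ge0.
have stepx n : (s n).1 <= (s n.+1).1 /\
    (s n.+1).1 + w / 2 ^+ n.+1 <= (s n).1 + w / 2 ^+ n.
  by have [_ /= /andP[? ?] _] := Hf (s n, n) (sbad n); split => //; rewrite (half w n); lra.
have stepy n : (s n).2 <= (s n.+1).2 /\
    (s n.+1).2 + h / 2 ^+ n.+1 <= (s n).2 + h / 2 ^+ n.
  by have [_ _ /= /andP[? ?]] := Hf (s n, n) (sbad n); split => //; rewrite (half h n); lra.
have [px Px] := @nested_point R (fun n => (s n).1) (fun n => (s n).1 + w / 2 ^+ n)
  (fun n => (stepx n).1) (fun n => (stepx n).2) (fun n => ltac:(by rewrite lerDl pw)).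
have [py Py] := @nested_point R (fun n => (s n).2) (fun n => (s n).2 + h / 2 ^+ n)
  (fun n => (stepy n).1) (fun n => (stepy n).2) (fun n => ltac:(by rewrite lerDl pw)).
exists px, py => n; exists (s n).1, (s n).2; split=> //.
  elim: n => [|n [IH1 IH2]]; first by rewrite expr0 divr1.
  by have [? ?] := stepx n; split; [exact: le_trans IH1 _|exact: le_trans IH2].
elim: n => [|n [IH1 IH2]]; first by rewrite expr0 divr1.
by have [? ?] := stepy n; split; [exact: le_trans IH1 _|exact: le_trans IH2].
Qed.

Lemma growth_bound (R : realType) (F f : R -> R) (a b M : R) :
  a <= b -> (forall x, a <= x <= b -> is_derive x 1 F (f x)) ->
  (forall x, a <= x <= b -> `|f x| <= M) -> `|F b - F a| <= M * (b - a).
Proof.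
move=> ab dF fM.
have [||c cab ->] := @MVT_segment R F f a b ab.
- by move=> x /subset_itv_oo_cc; rewrite in_itv/= => /dF.
- apply: derivable_within_continuous => x; rewrite in_itv/= => /dF ?.
  exact: ex_derive.
by rewrite normrM (ger0_norm (_ : 0 <= b - a)) ?subr_ge0// ler_wpM2r ?subr_ge0// fM.
Qed.

(** Integral of the differential form P dx + Q dy along the boundary of the
rectangle [x1, x2] x [y1, y2], where [B^~ y] is an antiderivative of [P^~ y] for
each y, and [A x] is an antiderivative of [Q x] for each x. *)
Definition rect_circ (R : realType) (B A : R -> R -> R) (x1 x2 y1 y2 : R) : R :=
  (B x2 y1 - B x1 y1) + (A x2 y2 - A x2 y1)
  - (B x2 y2 - B x1 y2) - (A x1 y2 - A x1 y1).

(** P is totally differentiable at (x, y), with partial derivatives a and b. *)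
Definition has_gradient (R : realType) (P : R -> R -> R) (x y a b : R) : Prop :=
  forall e : R, 0 < e -> exists2 d : R, 0 < d & forall x' y',
    `|x' - x| < d -> `|y' - y| < d ->
    `|P x' y' - P x y - (a * (x' - x) + b * (y' - y))|
      <= e * (`|x' - x| + `|y' - y|).

(** The closed form attached to the first-order expansions of P and Q at (px, py)
(the cross derivatives are both b) has a zero boundary integral, so only
the remainders of the two expansions contribute. *)
Lemma rect_circ_small (R : realType) (P Q B A : R -> R -> R) (x1 x2 y1 y2 : R)
    (px py a b c e D : R) : x1 <= px <= x2 -> y1 <= py <= y2 ->
  (forall x y, x1 <= x <= x2 -> y1 <= y <= y2 -> is_derive x 1 (B^~ y) (P x y)) ->
  (forall x y, x1 <= x <= x2 -> y1 <= y <= y2 -> is_derive y 1 (A x) (Q x y)) ->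
  (forall x y, x1 <= x <= x2 -> y1 <= y <= y2 ->
    `|P x y - P px py - (a * (x - px) + b * (y - py))| <= e * D) ->
  (forall x y, x1 <= x <= x2 -> y1 <= y <= y2 ->
    `|Q x y - Q px py - (b * (x - px) + c * (y - py))| <= e * D) ->
  `|rect_circ B A x1 x2 y1 y2| <= 2 * (e * D) * ((x2 - x1) + (y2 - y1)).
Proof.
move=> /andP[x1p px2] /andP[y1p py2] dB dA aP aQ.
have scalerE (u v : R) : u *: (v : R^o) = u * v by [].
have x12 := le_trans x1p px2; have y12 := le_trans y1p py2.
have bx y : y1 <= y <= y2 ->
    `|(B x2 y - B x1 y) - (P px py * (x2 - x1) +
       a * ((x2 - px) ^+ 2 - (x1 - px) ^+ 2) / 2 + b * (y - py) * (x2 - x1))|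
      <= e * D * (x2 - x1).
  move=> yy; pose F x := B x y - (P px py * x + a * (x - px) ^+ 2 / 2 + b * (y - py) * x).
  have := @growth_bound R F (fun x => P x y - P px py - (a * (x - px) + b * (y - py)))
    x1 x2 (e * D) x12 _ (fun x xx => aP x y xx yy).
  have -> : F x2 - F x1 = (B x2 y - B x1 y) - (P px py * (x2 - x1) +
       a * ((x2 - px) ^+ 2 - (x1 - px) ^+ 2) / 2 + b * (y - py) * (x2 - x1)).
    by rewrite /F; ring.
  apply => x xx; have dBx := dB x y xx yy; rewrite /F.
  by apply: is_derive_eq; rewrite !scalerE; field.
have ay x : x1 <= x <= x2 ->
    `|(A x y2 - A x y1) - (Q px py * (y2 - y1) +
       c * ((y2 - py) ^+ 2 - (y1 - py) ^+ 2) / 2 + b * (x - px) * (y2 - y1))|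
      <= e * D * (y2 - y1).
  move=> xx; pose F y := A x y - (Q px py * y + c * (y - py) ^+ 2 / 2 + b * (x - px) * y).
  have := @growth_bound R F (fun y => Q x y - Q px py - (b * (x - px) + c * (y - py)))
    y1 y2 (e * D) y12 _ (fun y yy => aQ x y xx yy).
  have -> : F y2 - F y1 = (A x y2 - A x y1) - (Q px py * (y2 - y1) +
       c * ((y2 - py) ^+ 2 - (y1 - py) ^+ 2) / 2 + b * (x - px) * (y2 - y1)).
    by rewrite /F; ring.
  apply => y yy; have dAx := dA x y xx yy; rewrite /F.
  by apply: is_derive_eq; rewrite !scalerE; field.
have := bx y1; have := bx y2; have := ay x1; have := ay x2.
rewrite !lexx x12 y12 => /(_ isT) + /(_ isT) + /(_ isT) + /(_ isT).
rewrite /rect_circ !ler_norml.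
move: (B x2 y1) (B x1 y1) (B x2 y2) (B x1 y2) (A x2 y2) (A x2 y1) (A x1 y2) (A x1 y1) => *.
lra.
Qed.

Lemma expr2_large (R : realType) (S d : R) : 0 < d -> exists n, S / 2 ^+ n < d.
Proof.
move=> d0; exists (Num.bound `|S / d|).
rewrite ltr_pdivrMr ?exprn_gt0// mulrC -ltr_pdivrMr//.
apply: le_lt_trans (ler_norm _) _; apply: lt_trans (archi_boundP (normr_ge0 _)) _.
by rewrite -natrX ltr_nat ltn_expl.
Qed.

(** Goursat's theorem.  No continuity of the partial derivatives is assumed. *)
Lemma rect_circ_eq0 (R : realType) (P Q B A : R -> R -> R) (x1 x2 y1 y2 : R) :
  x1 <= x2 -> y1 <= y2 ->
  (forall x y, x1 <= x <= x2 -> y1 <= y <= y2 ->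
     exists a b c, has_gradient P x y a b /\ has_gradient Q x y b c) ->
  (forall x y, x1 <= x <= x2 -> y1 <= y <= y2 -> is_derive x 1 (B^~ y) (P x y)) ->
  (forall x y, x1 <= x <= x2 -> y1 <= y <= y2 -> is_derive y 1 (A x) (Q x y)) ->
  rect_circ B A x1 x2 y1 y2 = 0.
Proof.
move=> x12 y12 aPQ dB dA; apply/eqP; rewrite -normr_le0 leNgt; apply/negP => I0.
set I := `|_| in I0; pose w := x2 - x1; pose h := y2 - y1.
have w0 : 0 <= w by rewrite subr_ge0.
have h0 : 0 <= h by rewrite subr_ge0.
(* A quarter is bad when it keeps its share of the total integral. *)
pose bad x y n := I / 4 ^+ n <=
  `|rect_circ B A x (x + w / 2 ^+ n) y (y + h / 2 ^+ n)|.
have bad0 : bad x1 y1 0%N.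
  by rewrite /bad !expr0 !divr1 /w /h !(addrC _ (_ - _)) !subrK.
have half (t : R) n : t / 2 ^+ n = t / 2 ^+ n.+1 + t / 2 ^+ n.+1.
  by rewrite exprS invfM; field; rewrite expf_neq0.
have quarter n : I / 4 ^+ n = 4 * (I / 4 ^+ n.+1).
  by rewrite exprS invfM; field; rewrite expf_neq0.
have step x y n : bad x y n -> exists x' y',
     [/\ bad x' y' n.+1, x <= x' <= x + w / 2 ^+ n.+1 &
         y <= y' <= y + h / 2 ^+ n.+1].
  set w' := w / 2 ^+ n.+1; set h' := h / 2 ^+ n.+1.
  have w'0 : 0 <= w' by rewrite divr_ge0 ?exprn_ge0.
  have h'0 : 0 <= h' by rewrite divr_ge0 ?exprn_ge0.
  move=> b; have [b1|n1] := pselect (bad x y n.+1).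
    by exists x, y; rewrite !lexx !lerDl.
  have [b2|n2] := pselect (bad (x + w') y n.+1).
    by exists (x + w'), y; rewrite !lexx !lerDl w'0.
  have [b3|n3] := pselect (bad x (y + h') n.+1).
    by exists x, (y + h'); rewrite !lexx !lerDl h'0.
  have [b4|n4] := pselect (bad (x + w') (y + h') n.+1).
    by exists (x + w'), (y + h'); rewrite !lexx !lerDl h'0 w'0.
  exfalso; move: b n1 n2 n3 n4; rewrite /bad (half w n) (half h n) -/w' -/h' quarter !addrA.
  move=> b /negP + /negP + /negP + /negP; rewrite -!ltNge => b1 b2 b3 b4.
  have E : rect_circ B A x (x + w' + w') y (y + h' + h') =
      rect_circ B A x (x + w') y (y + h') +
      rect_circ B A (x + w') (x + w' + w') y (y + h') +
      rect_circ B A x (x + w') (y + h') (y + h' + h') +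
      rect_circ B A (x + w') (x + w' + w') (y + h') (y + h' + h').
    by rewrite /rect_circ; ring.
  have := le_trans b _; rewrite E => /(_ _ (ler_normD _ _)).
  move: (ler_normD (rect_circ B A x (x + w') y (y + h') +
      rect_circ B A (x + w') (x + w' + w') y (y + h'))
      (rect_circ B A x (x + w') (y + h') (y + h' + h'))).
  move: (ler_normD (rect_circ B A x (x + w') y (y + h'))
      (rect_circ B A (x + w') (x + w' + w') y (y + h'))).
  by move: b1 b2 b3 b4; lra.
have [px [py near_p]] := bisection_point w0 h0 bad0 step.
(* With this e, the estimate [rect_circ_small] near (px, py) is less than I / 4^n. *)
pose e := I / (4 * ((w + h) ^+ 2 + 1)).
have S0 : 0 <= (w + h) ^+ 2 by exact: sqr_ge0.
have e0 : 0 < e by rewrite divr_gt0// mulr_gt0// ltr_wpDl.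
have [x0 [y0 [_ /andP[p1 p2] /andP[p3 p4] [p5 p6] [p7 p8]]]] := near_p 0%N.
have [||a [b [c [aP aQ]]]] := aPQ px py.
- by move: p1 p2 p6; rewrite expr0 divr1 /w; lra.
- by move: p3 p4 p8; rewrite expr0 divr1 /h; lra.
have [d1 d10 aP1] := aP e e0; have [d2 d20 aQ2] := aQ e e0.
have d0 : 0 < Num.min d1 d2 by rewrite lt_min d10.
have [n] := @expr2_large R (w + h) _ d0.
rewrite lt_min => /andP[n1 n2].
have [x [y [bxy xx yy [xl xr] [yl yr]]]] := near_p n.
have wn0 : 0 <= w / 2 ^+ n by rewrite divr_ge0 ?exprn_ge0.
have hn0 : 0 <= h / 2 ^+ n by rewrite divr_ge0 ?exprn_ge0.
have inx x' : x <= x' <= x + w / 2 ^+ n -> x1 <= x' <= x2.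
  by move: xl xr; rewrite /w; lra.
have iny y' : y <= y' <= y + h / 2 ^+ n -> y1 <= y' <= y2.
  by move: yl yr; rewrite /h; lra.
have close x' : x <= x' <= x + w / 2 ^+ n -> `|x' - px| <= w / 2 ^+ n.
  by move=> ?; rewrite ler_norml; lra.
have closey y' : y <= y' <= y + h / 2 ^+ n -> `|y' - py| <= h / 2 ^+ n.
  by move=> ?; rewrite ler_norml; lra.
rewrite mulrDl in n1 n2.
have h1 x' y' : x <= x' <= x + w / 2 ^+ n -> y <= y' <= y + h / 2 ^+ n ->
   e * (`|x' - px| + `|y' - py|) <= e * (w / 2 ^+ n + h / 2 ^+ n).
  by move=> /close ? /closey ?; rewrite ler_wpM2l ?lerD// ltW.
have := bxy; apply/negP; rewrite -ltNge.
apply: le_lt_trans (@rect_circ_small R P Q B A _ _ _ _ px py a b c e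
  (w / 2 ^+ n + h / 2 ^+ n) xx yy _ _ _ _) _.
- by move=> x' y' /inx ? /iny ?; exact: dB.
- by move=> x' y' /inx ? /iny ?; exact: dA.
- move=> x' y' xx' yy'; apply: le_trans (h1 _ _ xx' yy').
  have := close _ xx'; have := closey _ yy'.
  by move=> *; apply: aP1; lra.
- move=> x' y' xx' yy'; apply: le_trans (h1 _ _ xx' yy').
  have := close _ xx'; have := closey _ yy'.
  by move=> *; apply: aQ2; lra.
have -> : 4 ^+ n = 2 ^+ n * 2 ^+ n :> R by rewrite -exprMn -natrM.
rewrite /e.
set u := 2 ^+ n; have u0 : 0 < u by rewrite exprn_gt0.
rewrite -mulrDl.
have -> : x + w / u - x + (y + h / u - y) = (w + h) / u by field; rewrite gt_eqF.
rewrite ltr_pdivlMr ?mulr_gt0//.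
have -> : 2 * (I / (4 * ((w + h) ^+ 2 + 1)) * ((w + h) / u)) * ((w + h) / u) * (u * u) =
  I * ((w + h) ^+ 2 / (2 * ((w + h) ^+ 2 + 1))).
  by field; rewrite !gt_eqF// ltr_wpDl.
rewrite gtr_pMr// ltr_pdivrMr ?mulr_gt0 ?ltr_wpDl//; lra.
Qed.

Lemma continuous_dist (K : numFieldType) (f : K^o -> K^o) (z : K^o) :
  (forall e : K, 0 < e -> exists2 r : K, 0 < r & forall t, `|t - z| < r ->
     `|f t - f z| <= e) -> {for z, continuous f}.
Proof.
move=> H; apply/(@cvgrPdist_le K K^o _ (nbhs z)) => e /H[r r0 fr].
apply/nbhs_ballP; exists r => //= t; rewrite /ball/= distrC => /fr.
by rewrite distrC.
Qed.

Lemma has_gradient_continuous (R : realType) (P : R -> R -> R) (x y a b : R) :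
  has_gradient P x y a b ->
  {for x, continuous (P^~ y)} /\ {for y, continuous (P x)}.
Proof.
move=> aP; split; apply: (@continuous_dist R) => e e0; have [d d0 Pd] := aP _ ltr01.
  have a0 : 0 < 1 + `|a| by rewrite ltr_wpDr.
  exists (Num.min d (e / (1 + `|a|))); first by rewrite lt_min d0 divr_gt0.
  move=> t; rewrite lt_min => /andP[td te].
  have := Pd t y td; rewrite !subrr normr0 mulr0 !addr0 mul1r => /(_ d0) h.
  rewrite -[P t y - P x y](subrK (a * (t - x))).
  apply: le_trans (ler_normD _ _) _; rewrite normrM.
  by move: te; rewrite ltr_pdivlMr// mulrDr mulr1 (mulrC _ `|a|); lra.
have b0 : 0 < 1 + `|b| by rewrite ltr_wpDr.
exists (Num.min d (e / (1 + `|b|))); first by rewrite lt_min d0 divr_gt0.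
move=> t; rewrite lt_min => /andP[td te].
have := Pd x t _ td; rewrite !subrr normr0 mulr0 !add0r mul1r => /(_ d0) h.
rewrite -[P x t - P x y](subrK (b * (t - y))).
apply: le_trans (ler_normD _ _) _; rewrite normrM.
by move: te; rewrite ltr_pdivlMr// mulrDr mulr1 (mulrC _ `|b|); lra.
Qed.

Lemma is_derive_primitive (R : realType) (f : R -> R) (a b x : R) : a < x < b ->
  (forall t, a <= t <= b -> {for t, continuous f}) ->
  is_derive x 1 (fun u => \int[@lebesgue_measure R]_(t in `[a, u]) f t) (f x).
Proof.
move=> /andP[ax xb] cf.
have fi : (@lebesgue_measure R).-integrable `[a, b] (EFin \o f).
  apply: continuous_compact_integrable; first exact: segment_compact.
  apply: continuous_in_subspaceT => t; rewrite inE/= in_itv/= => ?; exact: cf.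
have [dF F'] := continuous_FTC1_closed xb fi ax (cf x ltac:(by rewrite !ltW)).
by rewrite -F' derive1E; exact/derivableP.
Qed.

(** Let P dx + Q dy be closed on the half-plane x < X, with P equal at the
heights 0 and T.  Then the integral of Q over a vertical segment of length T does
not depend on x, so Q takes a common value on any two such segments. *)
Lemma periodic_strip_value (R : realType) (P Q : R -> R -> R) (X T x1 x2 : R) :
  0 < T -> x1 < X -> x2 < X ->
  (forall x y, x < X -> exists a b c, has_gradient P x y a b /\ has_gradient Q x y b c) ->
  (forall x, P x T = P x 0) ->
  exists t1 t2, Q x1 t1 = Q x2 t2.
Proof.
move=> T0; wlog x12 : x1 x2 / x1 <= x2.
  move=> H x1X x2X aPQ PT; have [/H|/ltW/H] := leP x1 x2; first exact.
  by case/(_ x2X x1X aPQ PT) => t1 [t2 ?]; exists t2, t1.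
move=> x1X x2X aPQ PT.
have cP x y : x < X -> {for x, continuous (P^~ y)}.
  by case/(aPQ x y) => a [b [c [/has_gradient_continuous[]]]].
have cQ x y : x < X -> {for y, continuous (Q x)}.
  by case/(aPQ x y) => a [b [c [_ /has_gradient_continuous[]]]].
pose B (x y : R) : R := \int[@lebesgue_measure R]_(t in `[x1 - 1, x]) P t y.
pose A (x y : R) : R := \int[@lebesgue_measure R]_(t in `[-1, y]) Q x t.
have dB x y : x1 <= x <= x2 -> is_derive x 1 (B^~ y) (P x y).
  move=> xx; apply: (@is_derive_primitive R (P^~ y) _ ((x2 + X) / 2)); first lra.
  by move=> t tt; apply: cP; lra.
have dA x y : x < X -> 0 <= y <= T -> is_derive y 1 (A x) (Q x y).
  move=> xX yy; apply: (@is_derive_primitive R (Q x) _ (T + 1)); first lra.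
  by move=> t tt; exact: cQ.
have := @rect_circ_eq0 R P Q B A x1 x2 0 T x12 (ltW T0) _
  (fun x y xx _ => dB x y xx)
  (fun x y xx yy => dA x y (le_lt_trans (proj2 (andP xx)) x2X) yy).
have -> : rect_circ B A x1 x2 0 T = (A x2 T - A x2 0) - (A x1 T - A x1 0).
  rewrite /rect_circ; suff E x : B x T = B x 0 by rewrite !E; ring.
  by congr (fine _); apply: eq_integral => t _; rewrite PT.
have mv x : x < X -> exists t, A x T - A x 0 = Q x t * T.
  move=> xX; have [||c _ ->] := @MVT_segment R (A x) (Q x) 0 T (ltW T0).
  - by move=> y /subset_itv_oo_cc; rewrite in_itv/= => yy; exact: dA.
  - apply: derivable_within_continuous => y; rewrite in_itv/= => yy.
    by have ? := dA x y xX yy; exact: ex_derive.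
  by exists c; rewrite subr0.
have [t1 ->] := mv _ x1X; have [t2 ->] := mv _ x2X => I0.
exists t1, t2; apply: (@mulIf _ T); first by rewrite gt_eqF.
apply/esym/eqP; rewrite -subr_eq0; apply/eqP/I0.
by move=> x y xx _; apply: aPQ; lra.
Qed.

(** * The modulus of complex numbers *)

Lemma normc_ge0 (R : realType) (z : R[i]) : 0 <= Normc.normc z.
Proof. by case: z => x y; exact: sqrtr_ge0. Qed.

Lemma normE (R : realType) (z : R[i]) : `|z| = (Normc.normc z)%:C%C.
Proof. by case: z. Qed.

Lemma normc_sqr (R : realType) (z : R[i]) :
  Normc.normc z ^+ 2 = complex.Re z ^+ 2 + complex.Im z ^+ 2.
Proof. by case: z => x y /=; rewrite sqr_sqrtr ?addr_ge0 ?sqr_ge0. Qed.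

Lemma Re_le_normc (R : realType) (z : R[i]) : `|complex.Re z| <= Normc.normc z.
Proof.
rewrite -(@ler_pXn2r _ 2) ?nnegrE ?normc_ge0// normc_sqr real_normK ?num_real//.
by rewrite lerDl sqr_ge0.
Qed.

Lemma Im_le_normc (R : realType) (z : R[i]) : `|complex.Im z| <= Normc.normc z.
Proof.
rewrite -(@ler_pXn2r _ 2) ?nnegrE ?normc_ge0// normc_sqr real_normK ?num_real//.
by rewrite lerDr sqr_ge0.
Qed.

Lemma normc_le_ReIm (R : realType) (z : R[i]) :
  Normc.normc z <= `|complex.Re z| + `|complex.Im z|.
Proof.
rewrite -(@ler_pXn2r _ 2) ?nnegrE ?addr_ge0 ?normc_ge0// normc_sqr sqrrD.
by rewrite !real_normK ?num_real// addrAC lerDl mulrn_wge0 ?mulr_ge0.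
Qed.

Lemma Re_mul (R : realType) (u v : R[i]) : complex.Re (u * v) =
  complex.Re u * complex.Re v - complex.Im u * complex.Im v.
Proof. by case: u v => ? ? [? ?]. Qed.

Lemma Im_mul (R : realType) (u v : R[i]) : complex.Im (u * v) =
  complex.Re u * complex.Im v + complex.Im u * complex.Re v.
Proof. by case: u v => ? ? [? ?]. Qed.

Lemma normc_dist (R : realType) (u v : R[i]) :
  `|Normc.normc u - Normc.normc v| <= Normc.normc (u - v).
Proof.
have := le_normcD (v - u) u; have := le_normcD (u - v) v.
by rewrite !subrK -(opprB u v) normcN ler_norml; lra.
Qed.

Lemma normc_phase (R : realType) (z : R[i]) :
  exists2 u, Normc.normc u = 1 & u * z = (Normc.normc z)%:C%C.
Proof.
have [->|z0] := eqVneq z 0; first by exists 1; rewrite ?mulr0 ?Normc.normc0 // Normc.normc1.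
have nz0 : Normc.normc z != 0 by apply: contra z0 => /eqP/Normc.eq0_normc ->.
exists ((Normc.normc z)%:C%C / z); last by rewrite divfK.
rewrite Normc.normcM Normc.normcV /= expr0n/= addr0 sqrtr_sqr.
by rewrite ger0_norm ?normc_ge0// divff.
Qed.

Lemma normc_exp (R : realType) (z : R[i]) (k : nat) :
  Normc.normc (z ^+ k) = Normc.normc z ^+ k.
Proof.
elim: k => [|k IH]; first by rewrite !expr0 Normc.normc1.
by rewrite !exprS Normc.normcM IH.
Qed.

Lemma normc_nat (R : realType) (m : nat) : Normc.normc (m%:R : R[i]) = m%:R.
Proof.
by rewrite -(rmorph_nat (real_complex R)) /= expr0n/= addr0 sqrtr_sqr normr_nat.
Qed.

(** * The maximum modulus principle *)

(** The complex function g is differentiable at z, with derivative d; stated with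
the real-valued modulus. *)
Definition cdiff (R : realType) (g : R[i] -> R[i]) (z d : R[i]) : Prop :=
  forall e : R, 0 < e -> exists2 r : R, 0 < r & forall w, Normc.normc w < r ->
    Normc.normc (g (z + w) - g z - d * w) <= e * Normc.normc w.

(** The complex function g is continuous at z. *)
Definition ccont (R : realType) (g : R[i] -> R[i]) (z : R[i]) : Prop :=
  forall e : R, 0 < e -> exists2 r : R, 0 < r & forall w, Normc.normc w < r ->
    Normc.normc (g (z + w) - g z) <= e.

(** The complex exponential exp(x + i y). *)
Definition cexp (R : realType) (x y : R) : R[i] :=
  Complex (expR x * cos y) (expR x * sin y).

(** Used both for real functions and for complex ones. *)
Lemma derivable_approx (K : numFieldType) (f : K^o -> K^o) (x : K) :
  derivable f x 1 -> forall e : K, 0 < e -> exists2 r : K, 0 < r &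
    forall h, `|h| < r -> `|f (x + h) - f x - 'D_1 f x * h| <= e * `|h|.
Proof.
move=> df e e0; have := df; rewrite /derivable => /cvgrPdist_le/(_ e e0).
rewrite /dnbhs /within /= => /nbhs_ballP[r /= r0 H]; exists r => // h hr.
have [->|h0] := eqVneq h 0; first by rewrite addr0 subrr mulr0 subrr normr0 mulr0.
have := H h; rewrite /ball /= sub0r normrN => /(_ hr h0).
rewrite -/('D_1 f x) => D.
have -> : f (x + h) - f x - 'D_1 f x * h =
    - (('D_1 f x - h^-1 *: (f (h *: 1 + x) - f x)) * h).
  have -> : h *: (1 : K^o) + x = x + h by rewrite addrC /GRing.scale/= mulr1.
  have -> : h^-1 *: (f (x + h) - f x) = h^-1 * (f (x + h) - f x) by [].
  by field.
by rewrite normrN normrM ler_wpM2r.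
Qed.

Lemma has_gradient_mul (R : realType) (f g : R -> R) (x y a b : R) :
  is_derive x 1 f a -> is_derive y 1 g b -> (forall t, `|g t| <= 1) ->
  has_gradient (fun x y => f x * g y) x y (a * g y) (f x * b).
Proof.
move=> df dg g1 e e0.
have a0 : 0 < `|a| + 1 by rewrite ltr_wpDl.
have b0 : 0 < `|b| + 1 by rewrite ltr_wpDl.
have f0 : 0 < `|f x| + 1 by rewrite ltr_wpDl.
have e2 : 0 < e / 2 by rewrite divr_gt0.
have [r1 r10 H1] := derivable_approx (@ex_derive _ _ _ _ _ _ _ df) e2.
have e3 : 0 < Num.min 1 (e / (`|f x| + 1)) by rewrite lt_min ltr01 divr_gt0.
have [r2 r20 H2] := derivable_approx (@ex_derive _ _ _ _ _ _ _ dg) e3.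
rewrite (@derive_val _ _ _ _ _ _ _ df) in H1.
rewrite (@derive_val _ _ _ _ _ _ _ dg) in H2.
pose r3 := e / 2 / (`|a| + 1) / (`|b| + 1).
exists (Num.min r1 (Num.min r2 r3)); first by rewrite !lt_min r10 r20 !divr_gt0.
move=> x' y'; rewrite !lt_min => /and3P[h1 _ _] /and3P[_ k2 k3].
have Ex : x + (x' - x) = x' by ring.
have Ey : y + (y' - y) = y' by ring.
have := H1 _ h1; have := H2 _ k2; rewrite Ex Ey.
set h := x' - x in h1 *; set k := y' - y in k2 k3 *.
have -> : f x' * g y' - f x * g y - (a * g y * h + f x * b * k) =
   (f x' - f x - a * h) * g y' + f x * (g y' - g y - b * k) + a * h * (g y' - g y).
  by ring.
move=> G F.
have T1 : `|(f x' - f x - a * h) * g y'| <= e / 2 * `|h|.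
  by rewrite normrM; apply: le_trans F; rewrite ler_piMr.
have T2 : `|f x * (g y' - g y - b * k)| <= e * `|k|.
  rewrite normrM; apply: le_trans (_ : (`|f x| + 1) * (e / (`|f x| + 1) * `|k|) <= _).
    apply: ler_pM => //; first by rewrite lerDl.
    by apply: le_trans G _; rewrite ler_wpM2r// ge_min lexx orbT.
  by rewrite mulrA mulrCA divff ?gt_eqF// mulr1.
have gk : `|g y' - g y| <= (`|b| + 1) * `|k|.
  rewrite -(subrK (b * k) (g y' - g y)); apply: le_trans (ler_normD _ _) _.
  rewrite normrM mulrDl mul1r addrC lerD2l; apply: le_trans G _.
  by rewrite ler_piMl// ge_min lexx.
have T3 : `|a * h * (g y' - g y)| <= e / 2 * `|h|.
  rewrite !normrM mulrAC ler_wpM2r//.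
  apply: le_trans (_ : (`|a| + 1) * (e / 2 / (`|a| + 1)) <= _); last first.
    by rewrite mulrCA divff ?gt_eqF// mulr1.
  apply: ler_pM => //; first by rewrite lerDl.
  by apply: le_trans gk _; rewrite mulrC -ler_pdivlMr// ltW.
apply: le_trans (ler_normD _ _) _; apply: le_trans (lerD (ler_normD _ _) (lexx _)) _.
by move: T1 T2 T3; rewrite mulrDr; lra.
Qed.

Lemma normc_cexp (R : realType) (x y : R) : Normc.normc (cexp x y) = expR x.
Proof.
apply/eqP; rewrite -(@eqrXn2 _ 2) ?normc_ge0 ?expR_ge0// normc_sqr /=.
by rewrite !exprMn -mulrDr cos2Dsin2 mulr1.
Qed.

Lemma cexp_approx (R : realType) (x y e : R) : 0 < e ->
  exists2 d : R, 0 < d & forall x' y', `|x' - x| < d -> `|y' - y| < d ->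
    Normc.normc (cexp x' y' - cexp x y - cexp x y * Complex (x' - x) (y' - y))
      <= e * (`|x' - x| + `|y' - y|).
Proof.
move=> e0; have e20 : 0 < e / 2 by rewrite divr_gt0.
have [d1 d10 H1] := @has_gradient_mul R expR cos x y (expR x) (- sin y)
  _ _ (@cos_max R) _ e20.
have [d2 d20 H2] := @has_gradient_mul R expR sin x y (expR x) (cos y)
  _ _ (@sin_max R) _ e20.
exists (Num.min d1 d2); first by rewrite lt_min d10.
move=> x' y'; rewrite !lt_min => /andP[x1 x2] /andP[y1 y2].
apply: le_trans (normc_le_ReIm _) _.
have := lerD (H1 _ _ x1 y1) (H2 _ _ x2 y2); rewrite -mulrDl -splitr.
apply: le_trans; rewrite le_eqVlt; apply/orP; left; apply/eqP.
by rewrite /=; congr +%R; congr (Num.Def.normr); ring.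
Qed.

(** Chain rule and Cauchy-Riemann equations for g(a + exp(x + i y)). *)
Lemma comp_cexp_gradient (R : realType) (g : R[i] -> R[i]) (a d : R[i]) (x y : R) :
  cdiff g (a + cexp x y) d ->
  let z := d * cexp x y in
  has_gradient (fun x y => complex.Re (g (a + cexp x y))) x y
    (complex.Re z) (- complex.Im z) /\
  has_gradient (fun x y => complex.Im (g (a + cexp x y))) x y
    (complex.Im z) (complex.Re z).
Proof.
move=> gd z.
have main e : 0 < e -> exists2 r : R, 0 < r & forall x' y',
    `|x' - x| < r -> `|y' - y| < r ->
    Normc.normc (g (a + cexp x' y') - g (a + cexp x y) - z * Complex (x' - x) (y' - y))
      <= e * (`|x' - x| + `|y' - y|).
  move=> e0; pose L := expR x + 1; have L0 : 0 < L by rewrite addr_gt0 ?expR_gt0.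
  have D0 : 0 < Normc.normc d + 1 by rewrite ltr_wpDl ?normc_ge0.
  pose e1 := Num.min 1 (e / 2 / (Normc.normc d + 1)).
  have e10 : 0 < e1 by rewrite lt_min ltr01 !divr_gt0.
  have [r1 r10 H1] := cexp_approx x y e10.
  have e20 : 0 < e / 2 / L by rewrite !divr_gt0.
  have [r2 r20 H2] := gd _ e20.
  exists (Num.min r1 (r2 / 2 / L)); first by rewrite lt_min r10 !divr_gt0.
  move=> x' y'; rewrite !lt_min => /andP[xr1 xr2] /andP[yr1 yr2].
  set W := cexp x' y' - cexp x y; set s := `|x' - x| + `|y' - y|.
  have s0 : 0 <= s by rewrite addr_ge0.
  have K := H1 _ _ xr1 yr1; rewrite -/W -/s in K.
  have zs : Normc.normc (Complex (x' - x) (y' - y)) <= s by exact: normc_le_ReIm.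
  have WL : Normc.normc W <= L * s.
    rewrite -(subrK (cexp x y * Complex (x' - x) (y' - y)) W).
    apply: le_trans (le_normcD _ _) _; rewrite Normc.normcM normc_cexp mulrDl mul1r addrC.
    apply: lerD; first by rewrite ler_wpM2l ?expR_ge0.
    by apply: le_trans K _; rewrite ler_piMl// ge_min lexx.
  have Wr : Normc.normc W < r2.
    apply: le_lt_trans WL _; rewrite mulrC -ltr_pdivlMr//.
    by move: xr2 yr2; rewrite /s; lra.
  have EW : a + cexp x y + W = a + cexp x' y' by rewrite /W; ring.
  have := H2 _ Wr; rewrite EW => G.
  have -> : g (a + cexp x' y') - g (a + cexp x y) - z * Complex (x' - x) (y' - y) =
     (g (a + cexp x' y') - g (a + cexp x y) - d * W) +
     d * (W - cexp x y * Complex (x' - x) (y' - y)) by rewrite /z; ring.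
  apply: le_trans (le_normcD _ _) _; rewrite Normc.normcM.
  rewrite [e]splitr mulrDl; apply: lerD.
    apply: le_trans G _; rewrite mulrAC ler_pdivrMr//.
    by rewrite -[leRHS]mulrA (mulrC s) ler_wpM2l// ltW// divr_gt0.
  apply: le_trans (_ : (Normc.normc d + 1) * (e1 * s) <= _).
    by apply: ler_pM => //; rewrite ?normc_ge0// lerDl.
  rewrite mulrA ler_wpM2r// mulrC -ler_pdivlMr//.
  by rewrite ge_min lexx orbT.
clearbody z; split=> e /main[r r0 H]; exists r => // x' y' xr yr.
  apply: le_trans (H _ _ xr yr); apply: le_trans (Re_le_normc _).
  rewrite le_eqVlt; apply/orP; left; apply/eqP; congr (Num.Def.normr).
  by rewrite !raddfB/= Re_mul/=; ring.
apply: le_trans (H _ _ xr yr); apply: le_trans (Im_le_normc _).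
rewrite le_eqVlt; apply/orP; left; apply/eqP; congr (Num.Def.normr).
by rewrite !raddfB/= Im_mul/=; ring.
Qed.

(** If g is continuous at a and complex differentiable at the other points near a,
then Re g has no strict local maximum at a with a quadratic drop. *)
Lemma no_strict_peak (R : realType) (g : R[i] -> R[i]) (a : R[i]) (rho e : R) :
  0 < rho -> 0 < e -> ccont g a ->
  (forall w, 0 < Normc.normc w < rho -> exists d, cdiff g (a + w) d) ->
  exists2 w, Normc.normc w < rho &
    complex.Re (g a) - e * Normc.normc w ^+ 2 < complex.Re (g (a + w)).
Proof.
move=> rho0 e0 cg dg; apply: contrapT => /forall2NP peak.
pose x2 := ln rho - 1; pose m := e * expR x2 ^+ 2.
have m0 : 0 < m by rewrite mulr_gt0 ?exprn_gt0 ?expR_gt0.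
have [r r0 Hr] := cg (m / 2) (divr_gt0 m0 (ltr0Sn _ _)).
have mr0 : 0 < Num.min rho r by rewrite lt_min rho0.
(* The vertical line x = x2 corresponds to a fixed circle around a, and x = x1 to
   a circle so small that Re g is there within m / 2 of its value at a. *)
pose x1 := ln (Num.min rho r) - 1.
have x1r : expR x1 < Num.min rho r.
  by rewrite -[ltRHS]lnK ?posrE// ltr_expR /x1 ltrBlDr ltrDl.
have x2r : expR x2 < rho by rewrite -[ltRHS]lnK ?posrE// ltr_expR /x2 ltrBlDr ltrDl.
have lt_rho x : x < ln rho -> expR x < rho.
  by move=> xr; rewrite -[ltRHS]lnK ?posrE// ltr_expR.
have [|||x y xr|x|t1 [t2]] := @periodic_strip_value R
  (fun x y => complex.Im (g (a + cexp x y))) (fun x y => complex.Re (g (a + cexp x y)))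
  (ln rho) (2 * pi) x1 x2.
- by rewrite mulr_gt0 ?pi_gt0.
- by rewrite -ltr_expR lnK ?posrE//; apply: lt_le_trans x1r _; rewrite ge_min lexx.
- by rewrite /x2 ltrBlDr ltrDl.
- have [|d /comp_cexp_gradient[hQ hP]] := dg (cexp x y).
    by rewrite normc_cexp expR_gt0 lt_rho.
  by exists (complex.Im (d * cexp x y)), (complex.Re (d * cexp x y)),
    (- complex.Im (d * cexp x y)).
- by rewrite /cexp -[2 * pi]add0r mulr_natl cosD2pi sinD2pi.
move: x1r; rewrite lt_min => /andP[_ x1r].
have [/negP|/negP] := peak (cexp x2 t2); first by rewrite normc_cexp x2r.
rewrite -leNgt normc_cexp -/m => up eq12.
have := Hr (cexp x1 t1); rewrite normc_cexp => /(_ x1r).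
move=> /(le_trans (Re_le_normc _)); rewrite raddfB/= ler_norml eq12 => /andP[lo _].
move: lo up m0; lra.
Qed.

Lemma continuous_eps2 (R : realType) (f : R * R -> R) (p : R * R) :
  (forall e : R, 0 < e -> exists2 d : R, 0 < d & forall p',
     `|p'.1 - p.1| < d -> `|p'.2 - p.2| < d -> `|f p' - f p| <= e) ->
  {for p, continuous f}.
Proof.
move=> H; apply/cvgrPdist_le => e /H[d d0 fd].
apply: filterS (@nbhsx_ballx R (R * R)%type p d d0) => t [/= b1 b2].
by rewrite distrC; apply: fd; rewrite distrC.
Qed.

Lemma disc_EVT (R : realType) (r : R) (v : R[i] -> R) : 0 <= r ->
  (forall z, Normc.normc z <= r -> forall e : R, 0 < e ->
     exists2 d : R, 0 < d & forall w, Normc.normc w < d -> `|v (z + w) - v z| <= e) ->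
  exists2 z0, Normc.normc z0 <= r & forall z, Normc.normc z <= r -> v z <= v z0.
Proof.
move=> r0 cv; pose toC (p : R * R) : R[i] := Complex p.1 p.2.
have cont (p : R * R) (f : R[i] -> R) :
    (forall e : R, 0 < e -> exists2 d : R, 0 < d & forall w,
    Normc.normc w < d -> `|f (toC p + w) - f (toC p)| <= e) ->
    {for p, continuous (f \o toC)}.
  move=> H; apply: continuous_eps2 => e /H[d d0 fd].
  exists (d / 2); first by rewrite divr_gt0.
  move=> p' h1 h2 /=.
  have -> : toC p' = toC p + (toC p' - toC p) by rewrite addrC subrK.
  apply: fd.
  by apply: le_lt_trans (normc_le_ReIm _) _ => /=; lra.
pose D : set (R * R) := [set p | Normc.normc (toC p) <= r].
have Dcl : closed D.
  apply: (@preimage_closed _ _ ((@Normc.normc R) \o toC) [set x | x <= r]);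
    last exact: closed_le.
  move=> p _; apply: cont => e e0; exists e => // w we.
  by apply: le_trans (normc_dist _ _) _; rewrite addrAC subrr add0r ltW.
have Dco : compact D.
  apply: (@subclosed_compact _ D (`[-r, r] `*` `[-r, r])) => //.
    by apply: compact_setX; exact: segment_compact.
  move=> p /= pr; rewrite !in_itv /= -!ler_norml; split.
    exact: le_trans (Re_le_normc (toC p)) pr.
  exact: le_trans (Im_le_normc (toC p)) pr.
have [||p pD pmax] := @compact_EVT_max _ R (v \o toC) D _ Dco.
- exists (0, 0); have : Normc.normc (0 : R[i]) <= r by rewrite Normc.normc0.
  exact.
- apply: continuous_in_subspaceT => p; rewrite inE => pD; apply: cont.
  exact: cv.
exists (toC p); first by move: pD; rewrite inE.
by move=> [x y] zr; apply: (pmax (x, y)); rewrite inE.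
Qed.

(** Maximum modulus principle on the disc of radius r centred at 0.  The function
q is not required to be differentiable at 0. *)
Lemma max_modulus (R : realType) (q : R[i] -> R[i]) (r M : R) : 0 < r ->
  (forall z, Normc.normc z <= r -> ccont q z) ->
  (forall z, 0 < Normc.normc z < r -> exists d, cdiff q z d) ->
  (forall z, Normc.normc z = r -> Normc.normc (q z) <= M) ->
  forall c, Normc.normc c <= r -> Normc.normc (q c) <= M.
Proof.
move=> r0 cq dq qM c cr; rewrite leNgt; apply/negP => Mc.
pose eta := Normc.normc (q c) - M; pose e := eta / 2 / r ^+ 2.
have eta0 : 0 < eta by rewrite subr_gt0.
have e0 : 0 < e by rewrite !divr_gt0 ?exprn_gt0.
have er : e * r ^+ 2 = eta / 2 by rewrite mulfVK// gt_eqF ?exprn_gt0.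
pose v z := Normc.normc (q z) + e * Normc.normc z ^+ 2.
have [z0 z0r vmax] : exists2 z0, Normc.normc z0 <= r &
    forall z, Normc.normc z <= r -> v z <= v z0.
  apply: disc_EVT (ltW r0) _ => z zr t t0.
  have [d d0 qd] := cq z zr (t / 2) (divr_gt0 t0 (ltr0Sn _ _)).
  have K0 : 0 < e * (2 * r + 1) by rewrite mulr_gt0// addr_gt0 ?mulr_gt0.
  exists (Num.min d (Num.min 1 (t / 2 / (e * (2 * r + 1))))).
    by rewrite !lt_min d0 ltr01 !divr_gt0.
  move=> w; rewrite !lt_min => /and3P[wd w1 wt].
  have := le_trans (normc_dist _ _) (qd w wd).
  have : `|e * (Normc.normc (z + w) ^+ 2 - Normc.normc z ^+ 2)| <= t / 2.
    rewrite normrM gtr0_norm// subr_sqr normrM.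
    apply: le_trans (_ : e * (Normc.normc w * (2 * r + 1)) <= _); last first.
      by rewrite mulrCA -ler_pdivlMr// ltW.
    rewrite ler_wpM2l ?(ltW e0)//; apply: ler_pM => //.
      by apply: le_trans (normc_dist _ _) _; rewrite addrAC subrr add0r.
    rewrite ger0_norm ?addr_ge0 ?normc_ge0//.
    by have := le_normcD z w; move: zr w1; lra.
  rewrite /v !ler_norml; lra.
have [zr|zr] := leP r (Normc.normc z0).
  have zE : Normc.normc z0 = r by apply/eqP; rewrite eq_le z0r.
  have := vmax c cr; rewrite /v zE er.
  have := qM _ zE.
  have : 0 <= e * Normc.normc c ^+ 2
    by rewrite mulr_ge0 ?exprn_ge0 ?normc_ge0 ?ltW.
  by move: eta0; rewrite /eta; lra.
(* Since |z0 + w|^2 = |z0|^2 + 2 Re(z0^* w) + |w|^2, the linear term of g turns the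
   maximality of v at z0 into a quadratic drop of Re g around z0. *)
have [u u1 uq] := normc_phase (q z0).
pose b := Complex (2 * e * complex.Re z0) (- (2 * e * complex.Im z0)).
pose g z := u * q z + b * (z - z0).
(* The ball of radius rho around z0 lies in the disc, and avoids 0 unless z0 = 0. *)
pose rho := if z0 == 0 then r else Num.min (Normc.normc z0) (r - Normc.normc z0).
have nz0 : z0 != 0 -> 0 < Normc.normc z0.
  move=> h; rewrite lt_neqAle normc_ge0 andbT eq_sym.
  by apply: contra h => /eqP/Normc.eq0_normc ->.
have rho0 : 0 < rho.
  by rewrite /rho; case: ifPn => // /nz0 ?; rewrite lt_min subr_gt0 zr andbT.
have inr w : Normc.normc w < rho -> Normc.normc (z0 + w) < r.
  rewrite /rho; case: eqP => [->|_]; first by rewrite add0r.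
  by rewrite lt_min => /andP[_]; have := le_normcD z0 w; lra.
have gt0 w : 0 < Normc.normc w -> Normc.normc w < rho -> 0 < Normc.normc (z0 + w).
  rewrite /rho; case: eqP => [->|_]; first by rewrite add0r.
  rewrite lt_min => _ /andP[wz _].
  by have := le_normcD (z0 + w) (- w); rewrite addrK normcN; lra.
have [||w wr] := @no_strict_peak R g z0 rho e rho0 e0.
- move=> t t0; have [d d0 qd] := cq z0 z0r (t / 2) (divr_gt0 t0 (ltr0Sn _ _)).
  have B0 : 0 < Normc.normc b + 1 by rewrite ltr_wpDl ?normc_ge0.
  exists (Num.min d (t / 2 / (Normc.normc b + 1))); first by rewrite lt_min d0 !divr_gt0.
  move=> w; rewrite lt_min => /andP[/qd wd wt].
  have -> : g (z0 + w) - g z0 = u * (q (z0 + w) - q z0) + b * w by rewrite /g; ring.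
  apply: le_trans (le_normcD _ _) _; rewrite !Normc.normcM u1 mul1r.
  rewrite [t]splitr; apply: lerD => //.
  move: wt; rewrite ltr_pdivlMr// mulrC => /ltW; apply: le_trans.
  by rewrite ler_wpM2r ?normc_ge0// lerDl.
- move=> w /andP[w0 wrho]; have [|d dqd] := dq (z0 + w); first by rewrite gt0 ?inr.
  exists (u * d + b) => t /dqd[s s0 qs]; exists s => // w' /qs.
  have -> : g (z0 + w + w') - g (z0 + w) - (u * d + b) * w' =
    u * (q (z0 + w + w') - q (z0 + w) - d * w') by rewrite /g; ring.
  by rewrite [in X in _ -> X]Normc.normcM u1 mul1r.
apply/negP; rewrite -leNgt /g subrr mulr0 addr0 uq.
have -> : z0 + w - z0 = w by ring.
rewrite raddfD /= [complex.Re (b * w)]Re_mul /=.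
have := vmax _ (ltW (inr _ wr)); rewrite /v !normc_sqr !raddfD/=.
have := le_trans (ler_norm _) (Re_le_normc (u * q (z0 + w))).
rewrite Normc.normcM u1 mul1r.
move: (complex.Re (u * _)) (Normc.normc (q (z0 + w))) (Normc.normc (q z0)).
by move: (complex.Re z0) (complex.Im z0) (complex.Re w) (complex.Im w) => *; lra.
Qed.

(** * Traces of powers of matrices *)

Lemma trig_mulmx (F : comNzRingType) (N : nat) (A B : 'M[F]_N) :
  is_trig_mx A -> is_trig_mx B ->
  is_trig_mx (A *m B) /\ forall i, (A *m B) i i = A i i * B i i.
Proof.
move=> /is_trig_mxP tA /is_trig_mxP tB; split.
  apply/is_trig_mxP => i j ij; rewrite mxE big1// => l _.
  have [il|li] := ltnP i l; first by rewrite tA ?mul0r.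
  by rewrite (tB l j) ?mulr0// (leq_ltn_trans li).
move=> i; rewrite mxE (bigD1 i)//= big1 ?addr0// => l li.
have [il|il] := ltnP i l; first by rewrite tA ?mul0r.
by rewrite (tB l i) ?mulr0// ltn_neqAle il andbT.
Qed.

Lemma trig_exp (F : comNzRingType) (N : nat) (A : 'M[F]_N.+1) (k : nat) :
  is_trig_mx A -> is_trig_mx (A ^+ k) /\ forall i, (A ^+ k) i i = A i i ^+ k.
Proof.
move=> tA; elim: k => [|k [IH1 IH2]].
  by split=> [|i]; [exact: scalar_mx_is_trig|rewrite !expr0 mxE eqxx].
rewrite exprS; have [h1 h2] := trig_mulmx tA IH1; split=> // i.
by rewrite exprS -IH2 -h2.
Qed.

(** By triangularization, the trace of W^k is the sum of the k-th powers of the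
eigenvalues of W. *)
Lemma mxtrace_exp_le (R : realType) (N : nat) (W : 'M[R[i]]_N.+1) (k : nat) :
  spectral_ball W -> Normc.normc (\tr (W ^+ k)) <= N.+1%:R.
Proof.
move=> Wr; have eigW a : eigenvalue W a -> Normc.normc a <= 1.
  rewrite -in_spectrum => aW; apply: ltW; apply: le_lt_trans Wr.
  exact: (@le_bigmax_seq _ _ _ _ _ a).
have [P /unitarymx_unit Pu tT] := @Schur R[i] N.+1 W isT.
have {}tT : is_trig_mx (conjmx P W) by move: tT; rewrite /=.
set T := conjmx P W in tT; have TE : T = P *m W *m invmx P by rewrite /T conjumx.
have Tk : T ^+ k = P *m W ^+ k *m invmx P.
  elim: k => [|k IH]; first by rewrite !expr0 mulmx1 mulmxV.
  by rewrite !exprS IH TE -!mulmxE !mulmxA mulmxKV.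
have -> : \tr (W ^+ k) = \tr (T ^+ k).
  by rewrite Tk mxtrace_mulC mulmxA mulVmx// mul1mx.
have [_ dT] := trig_exp k tT.
rewrite /mxtrace; under eq_bigr do rewrite dT.
have T1 i : Normc.normc (T i i) <= 1.
  apply/eigW/(@eigenvalue_conjmx _ _ _ P); rewrite ?stablemx_unit ?row_free_unit//.
  rewrite -/T [_ \in _]eigenvalue_root_char char_poly_trig//.
  by rewrite (bigD1 i)//= rootM root_XsubC eqxx.
rewrite -[X in _ <= X%:R]card_ord -sumr_const.
elim/big_ind2: _ => [|x u y v h1 h2|i _]; first by rewrite Normc.normc0.
  by apply: le_trans (le_normcD _ _) _; exact: lerD.
elim: k {Tk dT} => [|k IH]; first by rewrite expr0 Normc.normc1.
by rewrite exprS Normc.normcM mulr_ile1// normc_ge0.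
Qed.

(** The trace of a power is a polynomial in the entries. *)
Lemma trace_exp_closed (K : comNzRingType) (T : Type) (N : nat)
    (Pr : (T -> K) -> Prop) (F : T -> 'M[K]_N.+1) (k : nat) :
  (forall c, Pr (fun=> c)) ->
  (forall f g, Pr f -> Pr g -> Pr (fun z => f z + g z)) ->
  (forall f g, Pr f -> Pr g -> Pr (fun z => f z * g z)) ->
  (forall i j, Pr (fun z => F z i j)) -> Pr (fun z => \tr (F z ^+ k)).
Proof.
move=> Pc PD PM PF.
have Psum I (r : seq I) (h : I -> T -> K) : (forall i, Pr (h i)) ->
    Pr (fun z => \sum_(i <- r) h i z).
  move=> Ph; elim: r => [|i r IH].
    under eq_fun do rewrite big_nil.
    exact: Pc.
  under eq_fun do rewrite big_cons.
  exact: PD.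
apply: (@Psum) => i; elim: k i {2}i => [|k IH] i j.
  under eq_fun do rewrite expr0.
  exact: Pc.
under eq_fun do rewrite exprS mxE.
by apply: Psum => l; exact: PM.
Qed.

(** * A Schwarz lemma for the spectral ball *)

Lemma derivable_cdiff (R : realType) (f : R[i] -> R[i]) (z : R[i]) :
  derivable (f : R[i]^o -> R[i]^o) z 1 -> exists d, cdiff f z d.
Proof.
move=> df; exists ('D_1 (f : R[i]^o -> R[i]^o) z) => e e0.
have e0' : 0 < e%:C%C :> R[i] by rewrite ltcR.
have [[r r'] r0 H] := derivable_approx df e0'.
move: r0; rewrite ltcE /= => /andP[/eqP r'0 r0]; exists r => // w wr.
have := H w; rewrite !normE r'0 -rmorphM/= lecR; apply.
by rewrite ltcR.
Qed.

Lemma continuous_ccont (R : realType) (f : R[i] -> R[i]) (z : R[i]) :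
  {for z, continuous (f : R[i]^o -> R[i]^o)} -> ccont f z.
Proof.
move=> /cvgrPdist_le cf e e0.
have e0' : 0 < e%:C%C :> R[i] by rewrite ltcR.
have /nbhs_ballP[[r r'] /= r0 H] := cf _ e0'.
move: r0; rewrite ltcE /= => /andP[/eqP r'0 r0]; exists r => // w wr.
have := H (z + w); rewrite /ball /= opprD addNKr normrN normE r'0 ltcR => /(_ wr).
by rewrite distrC normE lecR.
Qed.

Lemma cdiff_ccont (R : realType) (f : R[i] -> R[i]) (z d : R[i]) :
  cdiff f z d -> ccont f z.
Proof.
move=> df e e0; have [r r0 H] := df 1 ltr01.
have D0 : 0 < Normc.normc d + 1 by rewrite ltr_wpDl ?normc_ge0.
exists (Num.min r (e / (Normc.normc d + 1))); first by rewrite lt_min r0 divr_gt0.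
move=> w; rewrite lt_min => /andP[/H wr]; rewrite ltr_pdivlMr// => we.
rewrite -(subrK (d * w) (f (z + w) - f z)).
apply: le_trans (le_normcD _ _) _; rewrite Normc.normcM.
by move: wr we; lra.
Qed.

Lemma derivable_add (R : realType) (f g : R[i] -> R[i]) (z : R[i]) :
  derivable (f : R[i]^o -> R[i]^o) z 1 -> derivable (g : R[i]^o -> R[i]^o) z 1 ->
  derivable ((fun x => f x + g x) : R[i]^o -> R[i]^o) z 1.
Proof. by move=> df dg; exact: (derivableD df dg). Qed.

Lemma derivable_mul (R : realType) (f g : R[i] -> R[i]) (z : R[i]) :
  derivable (f : R[i]^o -> R[i]^o) z 1 -> derivable (g : R[i]^o -> R[i]^o) z 1 ->
  derivable ((fun x => f x * g x) : R[i]^o -> R[i]^o) z 1.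
Proof. by move=> df dg; exact: (derivableM df dg). Qed.

Lemma derivable_inv (R : realType) (z : R[i]) : z != 0 ->
  derivable ((fun x => x^-1) : R[i]^o -> R[i]^o) z 1.
Proof. by move=> z0; exact: (@derivableV _ _ (fun x : R[i]^o => x) z 1). Qed.

Lemma continuous_add (R : realType) (f g : R[i] -> R[i]) (z : R[i]) :
  {for z, continuous (f : R[i]^o -> R[i]^o)} ->
  {for z, continuous (g : R[i]^o -> R[i]^o)} ->
  {for z, continuous ((fun x => f x + g x) : R[i]^o -> R[i]^o)}.
Proof. by move=> cf cg; exact: (continuousD cf cg). Qed.

Lemma continuous_mul (R : realType) (f g : R[i] -> R[i]) (z : R[i]) :
  {for z, continuous (f : R[i]^o -> R[i]^o)} ->
  {for z, continuous (g : R[i]^o -> R[i]^o)} ->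
  {for z, continuous ((fun x => f x * g x) : R[i]^o -> R[i]^o)}.
Proof. by move=> cf cg; exact: (continuousM cf cg). Qed.

(** Schwarz lemma for the traces of the powers of F, up to the radius r. *)
Lemma trace_exp_schwarz (R : realType) (N : nat) (F : R[i] -> 'M[R[i]]_N.+1)
    (k : nat) (r : R) (c : R[i]) :
  holomorphic_disc F -> (forall z, unit_disc z -> spectral_ball (F z)) ->
  F 0 = 0 -> r < 1 -> Normc.normc c <= r ->
  Normc.normc (\tr (F c ^+ k)) <= N.+1%:R * (Normc.normc c / r) ^+ k.
Proof.
move=> hF sF F0 r1 cr.
have disc z : Normc.normc z <= r -> unit_disc z.
  by move=> zr; rewrite /unit_disc normE ltcR (le_lt_trans zr).
have [->|c0] := eqVneq c 0.
  have d0 : unit_disc (0 : R[i]) by rewrite /unit_disc normr0.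
  rewrite F0 Normc.normc0 mul0r; case: k => [|k].
    by have := mxtrace_exp_le 0 (sF 0 d0); rewrite !expr0 mulr1.
  by rewrite !exprS !mul0r mxtrace0 Normc.normc0 mulr0.
(* G(z) = F(z) / z, with value F'(0) at the removable singularity. *)
pose D : 'M[R[i]]_N.+1 := \matrix_(i, j) 'D_1 (fun x : R[i]^o => F x i j : R[i]^o) 0.
pose G z := if z == 0 then D else z^-1 *: F z.
pose q z := \tr (G z ^+ k).
have gt0 (z : R[i]) : z != 0 -> 0 < Normc.normc z.
  move=> h; rewrite lt_neqAle normc_ge0 andbT eq_sym.
  by apply: contra h => /eqP/Normc.eq0_normc ->.
have r0 : 0 < r := lt_le_trans (gt0 _ c0) cr.
have qE z : z != 0 -> q z = z^-1 ^+ k * \tr (F z ^+ k).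
  by move=> z0; rewrite /q /G (negPf z0) exprZn mxtraceZ.
have dq z : 0 < Normc.normc z -> Normc.normc z <= r -> exists d, cdiff q z d.
  move=> nz zr; have z0 : z != 0.
    by apply: contraTneq nz => ->; rewrite Normc.normc0 ltxx.
  have [|d dd] := @derivable_cdiff R (fun z => \tr ((z^-1 *: F z) ^+ k)) z.
    apply: (@trace_exp_closed _ R[i] N (fun f => derivable (f : R[i]^o -> R[i]^o) z 1)).
    - by move=> a; exact: derivable_cst.
    - by move=> f g df dg; exact: derivable_add.
    - by move=> f g df dg; exact: derivable_mul.
    - move=> i j; under eq_fun do rewrite mxE.
      apply: (@derivable_mul R (fun z => z^-1) (fun z => F z i j) z).
        exact: derivable_inv.
      by apply: hF; exact: disc.
  exists d => e /dd[s s0 H]; exists (Num.min s (Normc.normc z)).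
    by rewrite lt_min s0.
  move=> w; rewrite lt_min => /andP[/H ws wz].
  have zw : z + w != 0.
    by apply: contraTneq wz => /eqP; rewrite addrC addr_eq0 => /eqP->; rewrite normcN ltxx.
  by rewrite /q /G (negPf z0) (negPf zw).
have cq z : Normc.normc z <= r -> ccont q z.
  have [-> _|z0 zr] := eqVneq z 0; last by have [d /cdiff_ccont] := dq z (gt0 _ z0) zr.
  apply: continuous_ccont.
  apply: (@trace_exp_closed _ R[i] N
    (fun f => {for (0 : R[i]), continuous (f : R[i]^o -> R[i]^o)})).
  - by move=> a; exact: cst_continuous.
  - by move=> f g cf cg; exact: (@continuous_add R f g (0 : R[i]) cf cg).
  - by move=> f g cf cg; exact: (@continuous_mul R f g (0 : R[i]) cf cg).
  move=> i j; apply: continuous_dist => e e0.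
  have [|s s0 H] := derivable_approx (hF i j 0 _) e0.
    by apply: disc; rewrite Normc.normc0 ltW.
  exists s => // w; rewrite subr0 => /H; rewrite add0r F0 !mxE subr0 /G eqxx => ws.
  case: eqVneq => [_|w0]; first by rewrite subrr normr0 ltW.
  rewrite !mxE -(ler_pM2r (x := `|w|)) ?normr_gt0// -normrM mulrBl.
  by rewrite mulrAC mulVf// mul1r.
have qM z : Normc.normc z = r -> Normc.normc (q z) <= N.+1%:R / r ^+ k.
  move=> zr; have z0 : z != 0.
    by apply: contraTneq r0 => z0; rewrite -zr z0 Normc.normc0 ltxx.
  rewrite qE// Normc.normcM mulrC; apply: ler_pM; rewrite ?normc_ge0//.
    by apply/mxtrace_exp_le/sF/disc; rewrite zr.
  by rewrite normc_exp Normc.normcV zr exprVn.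
have := @max_modulus R q r _ r0 cq _ qM c cr; rewrite qE//.
rewrite Normc.normcM normc_exp Normc.normcV exprVn expr_div_n mulrA.
rewrite mulrC ler_pdivrMr ?exprn_gt0 ?gt0// mulrAC; apply.
by move=> z /andP[z0 zr]; apply: dq => //; exact: ltW.
Qed.

(** * Scalar multiples of a matrix unit *)

Lemma char_poly_delta (R : realType) (n : nat) (a : R[i]) :
  char_poly (a *: delta_mx 0 0 : 'M[R[i]]_n.+1) = 'X^n * ('X - a%:P).
Proof.
rewrite char_poly_trig; last first.
  apply/is_trig_mxP => i j ij; rewrite !mxE.
  have j0 : (j == 0) = false by apply/eqP => j0; rewrite j0 in ij.
  by rewrite j0 andbF mulr0.
rewrite big_ord_recl !mxE !eqxx mulr1 mulrC; congr (_ * _).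
rewrite (eq_bigr (fun=> 'X)) => [|i _]; first by rewrite prodr_const card_ord.
by rewrite !mxE /= mulr0 subr0.
Qed.

Lemma char_frac_delta (R : realType) (n : nat) (a z : R[i]) :
  char_frac z (a *: delta_mx 0 0 : 'M[R[i]]_n.+1) =
  - a / (n.+1%:R - n%:R * a * z).
Proof.
have sE j : (j <= n.+1)%N -> char_s (a *: delta_mx 0 0 : 'M[R[i]]_n.+1) j =
    (j == 0)%:R + (j == 1)%:R * a.
  move=> jn; rewrite /char_s char_poly_delta coefXnM.
  case: j jn => [|[|j]] jn.
  - by rewrite subn0 ltnNge leqnSn /= subSnn coefB coefX coefC /=; ring.
  - by rewrite subn1 /= ltnn subnn coefB coefX coefC /=; ring.
  - rewrite ifT; last by rewrite subSS ltn_subrL (leq_ltn_trans (leq0n j) jn).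
    by rewrite mulr0 /=; ring.
rewrite /char_frac; congr (_ / _).
  rewrite big_ltn// big_nat big1 ?addr0 => [|j /andP[j1 jn]]; last first.
    by rewrite sE//; case: j j1 {jn} => [|[|j]]//= _; ring.
  by rewrite sE//= expr0; ring.
rewrite big_ltn// subn0 sE//= expr0.
case: n sE => [|n] sE; first by rewrite big_geq//=; ring.
rewrite big_ltn// big_nat big1 ?addr0 => [|j /andP[j1 jn]]; last first.
  by rewrite sE 1?ltnW//; case: j j1 {jn} => [|[|j]]//= _; ring.
by rewrite sE//= subn1/=; ring.
Qed.

Lemma eigenvalue_delta (R : realType) (n : nat) (a b : R[i]) : (0 < n)%N ->
  eigenvalue (a *: delta_mx 0 0 : 'M[R[i]]_n.+1) b = (b == 0) || (b == a).
Proof.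
move=> n0; rewrite eigenvalue_root_char char_poly_delta rootM root_XsubC.
by rewrite /root hornerXn expf_eq0 n0.
Qed.

Lemma spectral_ball_delta (R : realType) (n : nat) (a : R[i]) : (0 < n)%N ->
  Normc.normc a < 1 -> spectral_ball (a *: delta_mx 0 0 : 'M[R[i]]_n.+1).
Proof.
move=> n0 a1; rewrite /spectral_ball /spectral_radius big_seq.
elim/big_ind: _ => // [x y x1 y1|b]; first by rewrite gt_max x1.
rewrite in_spectrum eigenvalue_delta// => /orP[]/eqP-> //.
by rewrite Normc.normc0.
Qed.

Lemma min_mult0 (R : realType) (n : nat) :
  (min_mult (0 : 'M[R[i]]_n.+1) 0%R <= 1)%N.
Proof.
have pX : mxminpoly (0 : 'M[R[i]]_n.+1) %| 'X
  by apply: mxminpoly_min; rewrite horner_mx_X.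
have p0 : mxminpoly (0 : 'M[R[i]]_n.+1) != 0 by rewrite monic_neq0 ?mxminpoly_monic.
rewrite leqNgt /min_mult mup_geq// subr0; apply/negP => /dvdp_trans/(_ pX).
by move=> /dvdp_leq; rewrite polyX_eq0 size_polyXn size_polyX => /(_ isT).
Qed.

Lemma max_blaschke_delta (R : realType) (n : nat) (a : R[i]) : (0 < n)%N ->
  Normc.normc a <= 1 ->
  Normc.normc a <= max_blaschke (0 : 'M[R[i]]_n.+1) (a *: delta_mx 0 0).
Proof.
move=> n0 a1.
have aS : a \in spectrum (a *: delta_mx 0 0 : 'M[R[i]]_n.+1).
  by rewrite in_spectrum eigenvalue_delta// eqxx orbT.
apply: le_trans (@le_bigmax_seq _ _ _ _ _ a xpredT _ aS isT).
have -> : spectrum (0 : 'M[R[i]]_n.+1) = [fset 0]%fset.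
  apply/fsetP => b; rewrite in_spectrum inE.
  by rewrite -(scale0r (delta_mx 0 0)) eigenvalue_delta// orbb.
rewrite big_seq_fset1 /pseudohyp rmorph0 mul0r !subr0 divr1.
case: min_mult (min_mult0 R n) => [|[|m]]// _; rewrite ?expr0 ?expr1//.
Qed.

Lemma trace_exp_delta (R : realType) (n : nat) (a : R[i]) (k : nat) :
  \tr ((a *: delta_mx 0 0 : 'M[R[i]]_n.+1) ^+ k.+1) = a ^+ k.+1.
Proof.
have E : (delta_mx 0 0 : 'M[R[i]]_n.+1) ^+ k.+1 = delta_mx 0 0.
  by elim: k => [//|k IH]; rewrite exprS IH -mulmxE mul_delta_mx.
rewrite exprZn E mxtraceZ /mxtrace (bigD1 0)//= big1 => [|i i0].
  by rewrite mxE eqxx addr0 mulr1.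
by rewrite mxE (negPf i0).
Qed.

(** The Pick matrix is [[1, 1], [1, d]] with d = (1 - |w|^2) / (1 - |c|^2) >= 1, so
its quadratic form at (x, y) is |x + y|^2 + (d - 1) |y|^2. *)
Lemma psd_pick_matrix0 (R : realType) (c w : R[i]) :
  `|w| <= `|c| -> `|c| < 1 -> psd (pick_matrix 0 c 0 w).
Proof.
move=> wc c1; split.
  apply/is_hermitianmxP; rewrite expr0 scale1r; apply/matrixP => i j.
  rewrite !mxE rmorphM fmorphV !rmorphB !rmorph1 !rmorphM/= !conjCK.
  by congr ((1 - _) / (1 - _)); rewrite mulrC.
move=> v; set x := v 0 0; set y := v 1 0.
have c20 : 0 < 1 - c^* * c by rewrite subr_gt0 mulrC -normCK expr_lt1.
pose D := (1 - w^* * w) / (1 - c^* * c).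
have D1 : 0 <= D - 1.
  rewrite subr_ge0 ler_pdivlMr// mul1r lerD2l lerN2 !(mulrC _^*) -!normCK.
  by rewrite ler_pXn2r ?nnegrE.
have -> : ((map_mx Num.conj v)^T *m pick_matrix 0 c 0 w *m v) 0 0 =
    (x + y) * (x + y)^* + (D - 1) * (y * y^*).
  rewrite mxE big_ord_recl big_ord1 !mxE !big_ord_recl !big_ord0 !mxE /=.
  rewrite (_ : lift ord0 ord0 = 1); last exact: val_inj.
  rewrite -/x -/y /tnth /= !rmorph0 !mul0r !mulr0 !subr0 invr1 -/D rmorphD.
  by ring.
by rewrite addr_ge0 ?mul_conjC_ge0// mulr_ge0 ?mul_conjC_ge0.
Qed.

Lemma char_frac_delta_le (R : realType) (n : nat) (z : R[i]) : `|z| <= 1 ->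
  `|char_frac z (2^-1 *: delta_mx 0 0 : 'M[R[i]]_n.+1)| <= n.+2%:R^-1.
Proof.
move=> z1; rewrite char_frac_delta normrM normfV normrN normfV normr_nat.
have den : n.+2%:R / 2 <= `|n.+1%:R - n%:R * 2^-1 * z|.
  apply: le_trans (lerB_dist _ _); rewrite !normrM normfV !normr_nat.
  apply: le_trans (_ : n.+1%:R - n%:R * 2^-1 * 1 <= _); last first.
    by rewrite lerD2l lerN2 ler_wpM2l// divr_ge0.
  rewrite le_eqVlt; apply/orP; left; apply/eqP.
  by rewrite -[in LHS]addn2 -[in RHS]addn1 !natrD; field.
have den0 : 0 < `|n.+1%:R - n%:R * 2^-1 * z|
  by apply: lt_le_trans den; rewrite divr_gt0 ?ltr0Sn.
rewrite ler_pdivrMr// -ler_pdivrMl ?invr_gt0 ?ltr0Sn// invrK.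
exact: den.
Qed.

Lemma not_interpolable_delta (R : realType) (n : nat) : (2 <= n)%N ->
  ~ interpolable 0 (n.+2%:R^-1) (0 : 'M[R[i]]_n.+1) (2^-1 *: delta_mx 0 0).
Proof.
move=> n2 [F [hF sF F0 Fc]].
have n3 : 3 <= n.+1%:R :> R by rewrite ler_nat.
have nE : n.+2%:R = n.+1%:R + 1 :> R by rewrite -natr1.
have cE : Normc.normc (n.+2%:R^-1 : R[i]) = n.+2%:R^-1.
  by rewrite Normc.normcV normc_nat.
(* For r = 3/4 and k = 2 N, the Schwarz lemma gives (1/4)^N <= N t^(2N) with
   t = |zeta2| / r <= 1/3; but 2 t^2 <= 1/4 and N < 2^N. *)
have := @trace_exp_schwarz R n F (n.+1.*2.-1.+1) (3 / 4) (n.+2%:R^-1) hF sF F0.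
rewrite cE Fc trace_exp_delta normc_exp Normc.normcV normc_nat prednK ?double_gt0//.
have r1 : 3 / 4 < 1 :> R by lra.
have cr : n.+2%:R^-1 <= 3 / 4 :> R.
  by rewrite invf_ple ?posrE ?ltr0Sn// ?divr_gt0// nE; lra.
move=> /(_ r1 cr); apply/negP; rewrite -ltNge.
rewrite -mul2n !exprM.
have sq : 2 * (n.+2%:R^-1 / (3 / 4)) ^+ 2 <= 2^-1 ^+ 2 :> R.
  have t0 : 0 <= n.+2%:R^-1 :> R by rewrite invr_ge0 ler0n.
  have t1 : n.+2%:R^-1 <= 1 / 4 :> R.
    by rewrite invf_ple ?posrE ?ltr0Sn// ?divr_gt0// nE; lra.
  by move: (n.+2%:R^-1 : R) t0 t1 => t t0 t1; nra.
apply: lt_le_trans (_ : 2 ^+ n.+1 * ((n.+2%:R^-1 / (3 / 4)) ^+ 2) ^+ n.+1 <= _).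
  rewrite ltr_pM2r; last by rewrite !exprn_gt0// divr_gt0 ?invr_gt0 ?ltr0Sn.
  by rewrite -natrX ltr_nat ltn_expl.
rewrite -exprMn; apply: lerXn2r sq; rewrite nnegrE.
  by rewrite mulr_ge0// exprn_ge0// divr_ge0 ?invr_ge0 ?ler0n.
by rewrite exprn_ge0.
Qed.

Theorem mainTheorem3 (R : realType) (n : nat) (hn : (3 <= n.+1)%N) :
  exists (zeta1 zeta2 : R[i]) (W1 W2 : 'M[R[i]]_n.+1),
    [/\ zeta1 <> zeta2,
        unit_disc zeta1 /\ unit_disc zeta2 &
        spectral_ball W1 /\ spectral_ball W2] /\
    [/\ ~ (Num.max (max_blaschke W1 W2) (max_blaschke W2 W1)
            <= pseudohyp zeta1 zeta2),
        ~ interpolable zeta1 zeta2 W1 W2 &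
        forall z, closed_unit_disc z ->
          psd (pick_matrix zeta1 zeta2 (char_frac z W1) (char_frac z W2))].
Proof.
have n0 : (0 < n)%N by apply: leq_trans (_ : 2 <= n)%N.
have c0 : (n.+2%:R : R[i]) != 0 by rewrite pnatr_eq0.
have c1 : `|n.+2%:R^-1 : R[i]| < 1.
  by rewrite normfV normr_nat invf_lt1 ?ltr0Sn// ltr1n.
have a1 : Normc.normc (2^-1 : R[i]) = 2^-1 by rewrite Normc.normcV normc_nat.
exists 0, (n.+2%:R^-1), 0, (2^-1 *: delta_mx 0 0); split; split.
- by move=> /eqP; rewrite eq_sym invr_eq0 (negPf c0).
- by rewrite /unit_disc normr0.
- split; last by apply: spectral_ball_delta => //; rewrite a1; lra.
  rewrite -(scale0r (delta_mx 0 0)); apply: spectral_ball_delta => //.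
  by rewrite Normc.normc0.
- apply/negP; rewrite -ltNge lt_max; apply/orP; left.
  apply: lt_le_trans (max_blaschke_delta n0 _); rewrite a1; last by lra.
  rewrite /pseudohyp mulr0 subr0 divr1 sub0r normcN Normc.normcV normc_nat.
  by rewrite ltf_pV2 ?posrE ?ltr0Sn// ltr_nat !ltnS.
- exact: not_interpolable_delta.
move=> z z1; rewrite -{1}(scale0r (delta_mx 0 0)) [char_frac z (0 *: _)]char_frac_delta.
rewrite oppr0 mul0r; apply: psd_pick_matrix0 => //.
rewrite [leRHS]normfV normr_nat; exact: char_frac_delta_le.
Qed.
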